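(* Let $q\equiv 3\pmod 4$ be a prime power and $S=S(\mathbb{F}_q)$. The sets $S_{00}^{00}$, $S_{00}^{11}$, $S_{11}^{00}$ and $S_{11}^{11}$ are empty, and $S_{10}^{01}=S_{01}^{10}$. Moreover, let $(x,y)\in S$ be such that [$y+1-x\ne0$ or $x^2-x-1\ne0$] and [$x+1-y\ne0$ or $y^2-y-1\ne0$]. Then $(x,y)$ belongs to each set below if and only if all the listed values are nonzero squares: \begin{itemize} \item $S_{01}^{10}$: $(1-y)(x-y)$ and $(1-x)(y-x)$; \item $S_{01}^{00}$: $(1-x)(x-y)$ and $g_1(x,y)(y-x)$; \item $S_{10}^{00}$: $(1-y)(y-x)$ and $g_2(x,y)(x-y)$; \item $S_{10}^{11}$: $(1-x)(x-y)$ and $g_3(x,y)(x-y)$; \item $S_{01}^{11}$: $(1-y)(y-x)$ and $g_4(x,y)(y-x)$; \item $S_{11}^{01}$: $(1-x)(x-y)$, $x-1-y$ and $(x-y)f_1(x,y)$; \item $S_{11}^{10}$: $(1-y)(y-x)$, $y-1-x$ and $(y-x)f_2(x,y)$; \item $S_{00}^{10}$: $(1-x)(x-y)$, $y-xy-x$ and $(x-y)f_3(x,y)$; \item $S_{00}^{01}$: $(1-y)(y-x)$, $x-xy-y$ and $(y-x)f_4(x,y)$; \item $S_{01}^{01}$: $(x-xy-y)(x-1-y)$, $g_1(x,y)(y-x)(x-1-y)$ and $g_4(x,y)(y-x)(x-1-y)$; \item $S_{10}^{10}$: $(y-xy-x)(y-1-x)$, $g_2(x,y)(x-y)(y-1-x)$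 and $g_3(x,y)(x-y)(y-1-x)$. \end{itemize}
   Context: Let $q$ be an odd prime power, $\mathbb{F}=\mathbb{F}_q$. A square is an element $z^2$, $z\in\mathbb{F}$; a nonsquare is an element that is not a square. $\Sigma$ is the set of $(a,b)\in\mathbb{F}^2$ with $a\ne b$, $a,b\notin\{0,1\}$ and $ab$, $(1-a)(1-b)$ squares. $S=S(\mathbb{F}_q)$ is the set of $(x,y)\in\mathbb{F}^2$ with $x,y$ squares, $x\ne y$, $\{x,y\}\cap\{0,1\}=\emptyset$. $\Psi:\Sigma\to S$ is $\Psi(a,b)=(a/b,(1-a)/(1-b))$. For $(a,b)\in\Sigma$ let $\psi=\psi_{a,b}:\mathbb{F}\to\mathbb{F}$, $\psi(u)=au$ if $u$ is a square and $\psi(u)=bu$ if $u$ is a nonsquare. Let $E(a,b)$ be the set of $(u,v)\in\mathbb{F}^2\setminus\{(0,0)\}$ with $\psi(\psi(u)-v)=\psi(-v)+\psi(u-v-\psi(-v))$. For $i,j,r,s\in\{0,1\}$, $E_{ij}^{rs}(a,b)$ is the set of $(u,v)\in E(a,b)$ such that: $i=0$ iff $u$ is a square; $j=0$ iff $-v$ is a square; $r=0$ iff $\psi(u)-v$ is a square; $s=0$ iff $u-v-\psi(-v)$ is a square. $\Sigma_{ij}^{rs}=\{(a,b)\in\Sigma: E_{ij}^{rs}(a,b)\ne\emptyset\}$ and $S_{ij}^{rs}=\Psi(\Sigma_{ij}^{rs})$. Polynomials: $f_1=x^2+y^2-xy-x$, $f_2=y^2+x^2-xy-y$, $f_3=y^2x+xy-x^2-y^2$,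 $f_4=x^2y+xy-x^2-y^2$, $g_1=x^2+y-2x$, $g_2=y^2+x-2y$, $g_3=x^2+y-2xy$, $g_4=y^2+x-2xy$. *)

(* Defs.v *)
From HB Require Import structures.
From mathcomp Require Import all_boot all_order all_algebra.

Set Implicit Arguments.
Unset Strict Implicit.
Unset Printing Implicit Defensive.

Import GRing.Theory.
Local Open Scope ring_scope.

(* Note that 0 is a square. *)
Definition square (F : finFieldType) (u : F) : bool := [exists z : F, u == z ^+ 2].

Definition nzsquare (F : finFieldType) (u : F) : bool := (u != 0) && square u.

Definition Sigma (F : finFieldType) : {set F * F} :=
  [set p : F * F | let: (a, b) := p in
     [&& a != b, a \notin [:: 0; 1], b \notin [:: 0; 1],
         square (a * b) & square ((1 - a) * (1 - b))]].

Definition Sset (F : finFieldType) : {set F * F} :=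
  [set p : F * F | let: (x, y) := p in
     [&& square x, square y, x != y, x \notin [:: 0; 1] & y \notin [:: 0; 1]]].

Definition Psi (F : finFieldType) (p : F * F) : F * F :=
  let: (a, b) := p in (a / b, (1 - a) / (1 - b)).

Definition psi (F : finFieldType) (a b u : F) : F :=
  if square u then a * u else b * u.

Definition E (F : finFieldType) (a b : F) : {set F * F} :=
  [set p : F * F | let: (u, v) := p in
     ((u, v) != (0, 0)) &&
     (psi a b (psi a b u - v)
        == psi a b (- v) + psi a b (u - v - psi a b (- v)))].

(* The indices i, j, r, s in {0, 1} are booleans, with false for 0 and true
   for 1. *)
Definition Eijrs (F : finFieldType) (i j r s : bool) (a b : F) : {set F * F} :=
  [set p in E a b | let: (u, v) := p in
     [&& (i == false) == square u,
         (j == false) == square (- v),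
         (r == false) == square (psi a b u - v) &
         (s == false) == square (u - v - psi a b (- v))]].

Definition Sigmaijrs (F : finFieldType) (i j r s : bool) : {set F * F} :=
  [set p in Sigma F | let: (a, b) := p in Eijrs i j r s a b != set0].

Definition Sijrs (F : finFieldType) (i j r s : bool) : {set F * F} :=
  [set Psi p | p in Sigmaijrs F i j r s].

Definition f1 (F : finFieldType) (x y : F) : F := x ^+ 2 + y ^+ 2 - x * y - x.
Definition f2 (F : finFieldType) (x y : F) : F := y ^+ 2 + x ^+ 2 - x * y - y.
Definition f3 (F : finFieldType) (x y : F) : F :=
  y ^+ 2 * x + x * y - x ^+ 2 - y ^+ 2.
Definition f4 (F : finFieldType) (x y : F) : F :=
  x ^+ 2 * y + x * y - x ^+ 2 - y ^+ 2.
Definition g1 (F : finFieldType) (x y : F) : F := x ^+ 2 + y - 2 * x.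
Definition g2 (F : finFieldType) (x y : F) : F := y ^+ 2 + x - 2 * y.
Definition g3 (F : finFieldType) (x y : F) : F := x ^+ 2 + y - 2 * x * y.
Definition g4 (F : finFieldType) (x y : F) : F := y ^+ 2 + x - 2 * x * y.

(* Main.v *)
Require Import Defs.
From mathcomp Require Import all_boot all_order all_algebra all_field.
From mathcomp Require Import ring.

(* For (x, y) in S, the only preimage under Psi is b = (1 - y) / (x - y), a = x b.
   Once the quadratic classes i, j, r, s are prescribed, the equation defining
   E(a, b) becomes linear: with c_0 = a and c_1 = b it reads
     u (c_r c_i - c_s) = v (c_r - c_j - c_s + c_s c_j),
   so its solutions form a line. Since -1 is a nonsquare, some multiple of a
   nonzero solution (u, v) has the prescribed classes iff the classes of -v,
   c_i u - v and u - v + c_j v relative to that of u are the prescribed ones.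
   Expressing these products in x and y and dropping square factors (among them
   x and y) gives the listed conditions. The two exclusions on (x, y) are exactly
   what keeps the linear equation from vanishing identically for (i, j, r, s) =
   (0, 1, 0, 1) and (1, 0, 1, 0). *)

Set Implicit Arguments.
Unset Strict Implicit.
Unset Printing Implicit Defensive.

Import GRing.Theory.
Local Open Scope ring_scope.

(** * Squares and signs in a field of order 3 mod 4 *)

Section Squares.

Variable F : finFieldType.
Hypothesis cardF : (#|F| = 3 %[mod 4])%N.

Lemma squareP (u : F) : reflect (exists z, u = z ^+ 2) (square u).
Proof. by apply: (iffP existsP) => -[z]; exists z; apply/eqP. Qed.

Lemma square_sqr (z : F) : square (z ^+ 2).
Proof. by apply/squareP; exists z. Qed.

Lemma square0 : square (0 : F).
Proof. by have := square_sqr 0; rewrite expr0n. Qed.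

Lemma squareMl (u v : F) : square u -> square v -> square (u * v).
Proof. by move=> /squareP[z ->] /squareP[w ->]; rewrite -exprMn square_sqr. Qed.

Lemma squareV (u : F) : square u -> square u^-1.
Proof. by move=> /squareP[z ->]; rewrite -exprVn square_sqr. Qed.

Lemma card_mod4 : {m | #|F| = (m * 4 + 3)%N}.
Proof. by exists (#|F| %/ 4)%N; rewrite [LHS](divn_eq _ 4) cardF. Qed.

(** The exponent is half of [#|F| - 1]; cancelling [z] in [z ^+ #|F| = z] suffices. *)
Lemma expf_half_card m (z : F) : #|F| = (m * 4 + 3)%N -> z != 0 ->
  (z ^+ (m.*2.+1)) ^+ 2 = 1.
Proof.
move=> Fm z0; apply: (mulfI z0); rewrite mulr1 -exprM -exprS.
by rewrite -[RHS]expf_card Fm; congr (_ ^+ _); rewrite -muln2; ring.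
Qed.

(** The sum of all elements is invariant under [x -> x + 1], so [#|F|] times 1 vanishes; as [#|F|]
    is odd, [-1 = 1] would give [1 = 0]. *)
Lemma oppr1_neq1 : -1 != 1 :> F.
Proof.
apply/eqP => N1; have [m Fm] := card_mod4.
have shift1 : injective (fun x : F => x + 1) by apply: addIr.
have: \sum_(x : F) x = \sum_(x : F) (x + 1) by exact: reindex_inj.
rewrite big_split /= sumr_const => /eqP; rewrite -subr_eq0 opprD addrA subrr sub0r.
have -> : #|F| = (2 * (m * 2 + 1) + 1)%N by rewrite Fm; ring.
by rewrite oppr_eq0 mulrnDr mulrnA mulr2n -{1}N1 addNr mul0rn add0r oner_eq0.
Qed.

Lemma square_opp1 : square (-1 : F) = false.
Proof.
apply/squareP => -[w w2]; have [m Fm] := card_mod4.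
have w0 : w != 0 by apply: contra_eq_neq w2 => ->; rewrite expr0n oppr_eq0 oner_eq0.
have := expf_half_card Fm w0; rewrite -exprM mulnC exprM -w2 -signr_odd /= odd_double.
by move/eqP; rewrite expr1 (negPf oppr1_neq1).
Qed.

(** One of [z], [- z] has power [m.*2.+1] equal to 1, this exponent being odd; an element [w] with
    that property is [w ^+ m.*2.+2], an even power. *)
Lemma square_or_opp (z : F) : square z || square (- z).
Proof.
have [-> | z0] := eqVneq z 0; first by rewrite square0.
have [m Fm] := card_mod4.
have sq (w : F) : w ^+ m.*2.+1 = 1 -> square w.
  by move=> w1; rewrite -[w]mulr1 -w1 -exprS -doubleS -muln2 exprM square_sqr.
have /eqP := expf_half_card Fm z0; rewrite sqrf_eq1 => /orP[]/eqP z1.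
  by rewrite sq.
by rewrite [square (- z)]sq ?orbT// exprNn z1 -signr_odd /= odd_double expr1 mulrNN mulr1.
Qed.

Lemma squareN (u : F) : u != 0 -> square (- u) = ~~ square u.
Proof.
move=> u0; have := square_or_opp u.
case: (boolP (square u)) => [su _|] //=.
case sNu: (square (- u)) => //; have := square_opp1.
by rewrite -(divff u0) -mulNr (squareMl sNu (squareV _)).
Qed.

Lemma squareM (u v : F) : u != 0 -> v != 0 ->
  square (u * v) = (square u == square v).
Proof.
move=> u0 v0; have uv0 : u * v != 0 by rewrite mulf_neq0.
case su: (square u); case sv: (square v); rewrite /=.
- by rewrite squareMl.
- apply/negbTE; rewrite -squareN// -mulrN squareMl// squareN// sv//.
- apply/negbTE; rewrite -squareN// -mulNr squareMl// squareN// su//.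
- by rewrite -mulrNN squareMl// squareN// ?su ?sv.
Qed.

(** This is how square factors are dropped below: each conversion of a condition reduces to a
    polynomial identity [c * z = d * w]. *)
Lemma nzsquareZ (c d z w : F) : nzsquare c -> nzsquare d -> c * z = d * w ->
  nzsquare z = nzsquare w.
Proof.
move=> /andP[c0 sc] /andP[d0 sd] e; rewrite /nzsquare.
have zw : (z == 0) = (w == 0).
  by rewrite -(mulrI_eq0 z (mulfI c0)) e mulrI_eq0//; apply: mulfI.
rewrite zw; have [//|w0] := eqVneq w 0.
have z0 : z != 0 by rewrite zw.
have := squareM c0 z0; rewrite e squareM// sc sd.
by rewrite !(eq_sym true) !eqb_id.
Qed.

(** Since -1 is a nonsquare, a sign encodes a prescribed class, so that square and nonsquare cases
    are treated uniformly. *)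
Lemma nzsquare_sign (e : bool) (z : F) :
  nzsquare ((-1) ^+ e * z) = (z != 0) && (square z == ~~ e).
Proof.
case: e; rewrite /nzsquare ?expr1 ?mulN1r ?expr0 ?mul1r ?oppr_eq0 /=.
  by have [//|z0] := eqVneq z 0; rewrite squareN//=; case: square.
by case: square.
Qed.

(** * The equation of [E] once the classes are prescribed *)

Definition branch (a b : F) (e : bool) := if e then b else a.

Lemma psiE (a b u : F) : psi a b u = branch a b (~~ square u) * u.
Proof. by rewrite /psi; case: square. Qed.

(** With all four classes known, each [psi] is multiplication by a constant, and [- psi a b (- v)]
    is [c j * v]. *)
Lemma in_Eijrs (a b u v : F) (i j r s : bool) (c := branch a b) :
  ((u, v) \in Eijrs i j r s a b) =
  [&& (u != 0) || (v != 0), square u == ~~ i, square (- v) == ~~ j,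
      square (c i * u - v) == ~~ r, square (u - v + c j * v) == ~~ s
    & u * (c r * c i - c s) == v * (c r - c j - c s + c s * c j)].
Proof.
rewrite !inE xpair_eqE negb_and !psiE -/c !eqbF_neg.
have [Ei|ni] := eqVneq (square u) (~~ i); last by rewrite !(andbF, andFb).
have [Ej|nj] := eqVneq (square (- v)) (~~ j); last by rewrite !(andbF, andFb).
rewrite Ei Ej (negbK i) (negbK j) mulrN opprK.
have [Er|nr] := eqVneq (square (c i * u - v)) (~~ r); last by rewrite !(andbF, andFb).
have [Es|ns] := eqVneq (square (u - v + c j * v)) (~~ s); last by rewrite !(andbF, andFb).
rewrite Er Es (negbK r) (negbK s) !andbT; congr (_ && _).
rewrite -subr_eq0 -[RHS]subr_eq0; congr (_ == 0); ring.
Qed.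

(** * The bijection [Psi] and its inverse *)

Lemma in_Sigma (a b : F) : ((a, b) \in Sigma F) =
  [&& a != b, (a != 0) && (a != 1), (b != 0) && (b != 1),
      square (a * b) & square ((1 - a) * (1 - b))].
Proof. by rewrite !inE !negb_or. Qed.

Lemma in_Sset (x y : F) : ((x, y) \in Sset F) =
  [&& square x, square y, x != y, (x != 0) && (x != 1) & (y != 0) && (y != 1)].
Proof. by rewrite !inE !negb_or. Qed.

Lemma squareMsqr (c z : F) : z != 0 -> square (c * z ^+ 2) = square c.
Proof.
move=> z0; have [->|c0] := eqVneq c 0; first by rewrite mul0r square0.
by rewrite squareM// ?expf_neq0// square_sqr; case: square.
Qed.

(** Substituting [a = x * b] into [1 - a = y * (1 - b)] gives [b * (x - y) = 1 - y]. *)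
Definition PsiV2 (x y : F) : F := (1 - y) / (x - y).
Definition PsiV1 (x y : F) : F := x * PsiV2 x y.

Lemma Psi_Sset (p : F * F) : p \in Sigma F -> Psi p \in Sset F.
Proof.
case: p => a b; rewrite in_Sigma => /and5P[ab /andP[a0 a1] /andP[b0 b1] sab s1ab].
have b1' : 1 - b != 0 by rewrite subr_eq0 eq_sym.
have a1' : 1 - a != 0 by rewrite subr_eq0 eq_sym.
rewrite in_Sset; apply/and5P; split.
- by rewrite -(squareMsqr _ b0); congr (is_true (square _)): sab; field.
- by rewrite -(squareMsqr _ b1'); congr (is_true (square _)): s1ab; field.
- apply: contraNneq ab => e; rewrite -subr_eq0.
  have -> : a - b = (a / b - (1 - a) / (1 - b)) * b * (1 - b) by field; apply/andP.
  by rewrite e subrr !mul0r.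
- rewrite mulf_neq0 ?invr_eq0//= -subr_eq0.
  have -> : a / b - 1 = (a - b) / b by field.
  by rewrite mulf_neq0 ?invr_eq0// subr_eq0.
- rewrite mulf_neq0 ?invr_eq0//= -subr_eq0.
  have -> : (1 - a) / (1 - b) - 1 = (b - a) / (1 - b) by field.
  by rewrite mulf_neq0 ?invr_eq0// subr_eq0 eq_sym.
Qed.

Lemma PsiK (a b : F) : (a, b) \in Sigma F ->
  a = PsiV1 (Psi (a, b)).1 (Psi (a, b)).2 /\
  b = PsiV2 (Psi (a, b)).1 (Psi (a, b)).2.
Proof.
move=> abS; have := Psi_Sset abS; rewrite in_Sset => /and5P[_ _ xy _ _].
move: abS; rewrite in_Sigma => /and5P[ab /andP[a0 a1] /andP[b0 b1] _ _].
have b1' : 1 - b != 0 by rewrite subr_eq0 eq_sym.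
have E : PsiV2 (a / b) ((1 - a) / (1 - b)) = b.
  rewrite /PsiV2; apply: (canLR (mulfK _)); first by rewrite subr_eq0.
  by field; apply/andP.
by rewrite /PsiV1 /= E divfK.
Qed.

(** Here [a * b = x * b ^+ 2] and [(1 - a) * (1 - b) = y * (1 - b) ^+ 2], which are squares because
    [x] and [y] are. *)
Lemma inv_Sigma (x y : F) : (x, y) \in Sset F ->
  (PsiV1 x y, PsiV2 x y) \in Sigma F /\ Psi (PsiV1 x y, PsiV2 x y) = (x, y).
Proof.
rewrite in_Sset => /and5P[sx sy xy /andP[x0 x1] /andP[y0 y1]].
have D0 : x - y != 0 by rewrite subr_eq0.
have N0 : 1 - y != 0 by rewrite subr_eq0 eq_sym.
have M0 : x - 1 != 0 by rewrite subr_eq0.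
have b0 : PsiV2 x y != 0 by rewrite mulf_neq0 ?invr_eq0.
have b1E : 1 - PsiV2 x y = (x - 1) / (x - y) by rewrite /PsiV2; field.
have a1E : 1 - PsiV1 x y = y * (1 - PsiV2 x y) by rewrite /PsiV1 /PsiV2; field.
have b1 : 1 - PsiV2 x y != 0 by rewrite b1E mulf_neq0 ?invr_eq0.
split; last by rewrite /= a1E /PsiV1 !mulfK.
rewrite in_Sigma; apply/and5P; split.
- rewrite -subr_eq0.
  have -> : PsiV1 x y - PsiV2 x y = (x - 1) * PsiV2 x y by rewrite /PsiV1; ring.
  by rewrite mulf_neq0.
- by rewrite mulf_neq0//= eq_sym -subr_eq0 a1E mulf_neq0.
- by rewrite b0 /= eq_sym -subr_eq0.
- by rewrite -mulrA -expr2 squareMsqr.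
- by rewrite a1E -mulrA -expr2 squareMsqr.
Qed.

Lemma Sijrs_sub i j r s (p : F * F) : p \in Sijrs F i j r s -> p \in Sset F.
Proof. by case/imsetP => p'; rewrite inE => /andP[pS _] ->; apply: Psi_Sset. Qed.

Lemma in_Sijrs i j r s (x y : F) : (x, y) \in Sset F ->
  ((x, y) \in Sijrs F i j r s) = (Eijrs i j r s (PsiV1 x y) (PsiV2 x y) != set0).
Proof.
move=> xyS; have [abS Pab] := inv_Sigma xyS; apply/imsetP/idP => [[[a b]]|E0].
  rewrite inE => /andP[/PsiK + E0] e; rewrite -e /= => -[<- <-]//.
by exists (PsiV1 x y, PsiV2 x y); rewrite ?Pab// inE abS.
Qed.

(** * Solutions with prescribed classes as points of a line *)

Lemma branch_Sigma (a b : F) (c := branch a b) : (a, b) \in Sigma F ->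
  [/\ forall e, c e != 0, forall e, 1 - c e != 0,
      forall e e', square (c e) = square (c e') &
      forall e e', square (1 - c e) = square (1 - c e')].
Proof.
rewrite in_Sigma => /and5P[_ /andP[a0 a1] /andP[b0 b1] sab s1ab].
have b1' : 1 - b != 0 by rewrite subr_eq0 eq_sym.
have a1' : 1 - a != 0 by rewrite subr_eq0 eq_sym.
move: sab s1ab; rewrite !squareM// => /eqP sab /eqP s1ab.
by split; do ?case.
Qed.

(** A vanishing quantity has the class of a square and makes two of the others proportional by known
    factors; this forces relations among the indices, and each premise contradicts them. *)
Lemma Eijrs_nonzero (a b u v : F) (i j r s : bool) (c := branch a b) :
  (a, b) \in Sigma F -> (u, v) \in Eijrs i j r s a b ->
  [/\ i || (r != j) -> u != 0, j || (s != i) -> v != 0,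
      [|| r, s == j | i == j] -> c i * u - v != 0 &
      s || (r != j) -> u - v + c j * v != 0].
Proof.
move=> /(@branch_Sigma a b); rewrite in_Eijrs -/c => -[c0 c10 cc c1c1].
move=> /and5P[uv0 /eqP su /eqP sv /eqP sr /andP[/eqP ss /eqP E]].
split; apply: contraTneq => z0.
- move: su sr; rewrite z0 mulr0 sub0r sv square0.
  by case: (i); case: (r); case: (j).
- move: sv ss; rewrite z0 mulr0 addr0 subr0 su oppr0 square0.
  by case: (i); case: (s); case: (j).
(* The equation reduces to [c s * w = c j * v], so [w] and [v] have the same class and [j = ~~ s];
   with [r = false], only [i = j] is left to refute. *)
- have vE : v = c i * u by apply/esym/eqP; rewrite -subr_eq0 z0.
  have u0 : u != 0.
    by apply: contraTneq uv0 => u0; rewrite vE u0 mulr0 eqxx.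
  have v0 : v != 0 by rewrite vE mulf_neq0.
  have {}sv : square v = j by apply: negb_inj; rewrite -squareN.
  set w := u - v + c j * v in ss.
  have wE : c s * w = c j * v.
    apply/eqP; rewrite -subr_eq0; apply/eqP.
    transitivity (c r * (c i * u - v)
      - (u * (c r * c i - c s) - v * (c r - c j - c s + c s * c j))).
      by rewrite /w; ring.
    by rewrite E z0; ring.
  have w0 : w != 0.
    by apply: contra_eq_neq wE => ->; rewrite mulr0 eq_sym mulf_neq0.
  have sw : square w = square v.
    have := congr1 (@square F) wE; rewrite !squareM// (cc s j).
    by do 3 case: (square _).
  have js : j = ~~ s by rewrite -sv -sw.
  have r0 : r = false by move: sr; rewrite z0 square0; case: (r).
  rewrite r0 js; case: (i =P ~~ s) => [ij|_]; last by case: (s).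
  (* With [c i = c j], cancelling [u] gives [c s * p = (c i) ^+ 2] for
     [p := 1 - c i + (c i) ^+ 2], hence [(1 - c s) * p = 1 - c i]: so [p] is a
     square, then [c i] is, and [v = c i * u] has the class of [u]. *)
  have cij : c j = c i by rewrite ij js.
  pose p := 1 - c i + c i ^+ 2.
  have csp : c s * p = c i ^+ 2.
    apply: (mulfI u0); transitivity (c s * w); last by rewrite wE cij vE; ring.
    by rewrite /w cij vE /p; ring.
  have p0 : p != 0 by apply: contra_eq_neq csp => ->; rewrite mulr0 eq_sym expf_neq0.
  have sp : square p.
    have /(congr1 (@square F)) : (1 - c s) * p = 1 - c i by rewrite mulrBl csp /p; ring.
    by rewrite squareM// (c1c1 s i); do 2 case: (square _).
  have si : square (c i).
    by rewrite (cc i s); have := congr1 (@square F) csp;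
      rewrite squareM// sp square_sqr; case: (square _).
  by have := sv; rewrite vE squareM// si su ij js; case: (s).
(* The equation reduces to [c r * (c i * u - v) = c j * - v], which forces [r = j]. *)
- have s0 : s = false by move: ss; rewrite z0 square0; case: (s).
  have vE : c j * v = v - u by rewrite -[RHS]addr0 -z0; ring.
  have v0 : v != 0.
    apply: contraTneq uv0 => v0; move: vE; rewrite v0 mulr0 sub0r => /esym/eqP.
    by rewrite oppr_eq0 => /eqP->; rewrite eqxx.
  have E' : c r * (c i * u - v) = c j * - v.
    apply/eqP; rewrite -subr_eq0; apply/eqP.
    transitivity (u * (c r * c i - c s) - v * (c r - c j - c s + c s * c j)
      + c s * (u - v + c j * v)); first by ring.
    by rewrite E z0; ring.
  have l0 : c i * u - v != 0.
    by apply: contra_eq_neq E' => ->; rewrite mulr0 eq_sym mulf_neq0 ?oppr_eq0.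
  have := congr1 (@square F) E'; rewrite !squareM ?oppr_eq0// sr sv (cc r j) s0.
  by case: (square _); case: (r); case: (j).
Qed.

(* The last four hypotheses ask for the nonvanishing of a coordinate only where
   [Eijrs_nonzero] does not provide it: 0 counts as a square, so a vanishing
   coordinate would otherwise escape the [nzsquare] conditions. *)
Lemma Eijrs_line (a b u v z3 z4 k : F) (i j r s : bool) (c := branch a b) :
  (a, b) \in Sigma F -> k != 0 -> (u != 0) || (v != 0) ->
  c r * c i - c s = k * v -> c r - c j - c s + c s * c j = k * u ->
  c i * u - v = z3 -> u - v + c j * v = z4 ->
  i || (r != j) || (u != 0) -> j || (s != i) || (v != 0) ->
  [|| r, s == j | i == j] || (z3 != 0) -> s || (r != j) || (z4 != 0) ->
  (Eijrs i j r s a b != set0) =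
  [&& nzsquare ((-1) ^+ (i (+) j) * (u * - v)),
      nzsquare ((-1) ^+ (i (+) r) * (u * z3)) &
      nzsquare ((-1) ^+ (i (+) s) * (u * z4))].
Proof.
move=> abS k0 uv0 Ev Eu z3E z4E hu hv h3 h4.
rewrite !nzsquare_sign !mulf_eq0 !negb_or oppr_eq0.
apply/set0Pn/idP => [[[u' v'] uvE]|].
  have [nu nv n3 n4] := Eijrs_nonzero abS uvE.
  move: uvE; rewrite in_Eijrs -/c Ev Eu in nu nv n3 n4 *.
  case/and5P=> uv'0 /eqP su /eqP sv /eqP sr /andP[/eqP ss /eqP E].
  have {}E : u' * v = v' * u by apply: (mulfI k0); rewrite mulrCA E mulrCA.
  (* Every solution is a multiple of the spanning vector [(u, v)]. The unknown class of [t] will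
     cancel when classes are compared with that of [u]. *)
  have [t u'E v'E] : exists2 t, u' = t * u & v' = t * v.
    case/orP: uv0 => [u0|v0]; first by exists (u' / u); rewrite ?divfK// mulrAC E mulfK.
    by exists (v' / v); rewrite ?divfK// mulrAC -E mulfK.
  have t0 : t != 0.
    by apply: contraTneq uv'0 => t0; rewrite u'E v'E t0 !mul0r eqxx.
  have e3 : c i * u' - v' = t * z3 by rewrite u'E v'E -z3E; ring.
  have e4 : u' - v' + c j * v' = t * z4 by rewrite u'E v'E -z4E; ring.
  have e2 : - v' = t * - v by rewrite v'E mulrN.
  rewrite -/c e3 e4 in n3 n4; rewrite e3 in sr; rewrite e4 in ss; rewrite e2 in sv.
  rewrite u'E in nu su; rewrite v'E in nv.
  have u0 : u != 0 by case/orP: hu => // /nu; rewrite mulf_eq0 negb_or => /andP[].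
  have v0 : v != 0 by case/orP: hv => // /nv; rewrite mulf_eq0 negb_or => /andP[].
  have z30 : z3 != 0 by case/orP: h3 => // /n3; rewrite mulf_eq0 negb_or => /andP[].
  have z40 : z4 != 0 by case/orP: h4 => // /n4; rewrite mulf_eq0 negb_or => /andP[].
  rewrite !squareM ?oppr_eq0// in su sv sr ss.
  rewrite u0 v0 z30 z40 !squareM ?oppr_eq0//=.
  move: su sv sr ss; move: (square t) (square u) (square (- v)) (square z3) (square z4).
  by case: (i); case: (j); case: (r); case: (s); do 5 case.
case/and3P=> /andP[/andP[u0 v0] s2] /andP[/andP[_ z30] s3] /andP[/andP[_ z40] s4].
(* Exactly one of [u], [- u] has class [i]; the conditions then carry the other three classes
   along. *)
pose t : F := if square u == ~~ i then 1 else -1.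
have t0 : t != 0 by rewrite /t; case: ifP; rewrite ?oppr_eq0 oner_eq0.
have st : square t = (square u == ~~ i).
  by rewrite /t; case: ifP; rewrite ?square_opp1// -(expr1n _ 2) square_sqr.
exists (t * u, t * v); rewrite in_Eijrs -/c Ev Eu.
have -> : c i * (t * u) - t * v = t * z3 by rewrite -z3E; ring.
have -> : t * u - t * v + c j * (t * v) = t * z4 by rewrite -z4E; ring.
rewrite -mulrN mulf_neq0//= !squareM ?oppr_eq0// in s2 s3 s4 *.
rewrite st; move: s2 s3 s4.
have -> : t * u * (k * v) == t * v * (k * u) by apply/eqP; ring.
move: (square u) (square (- v)) (square z3) (square z4).
by case: (i); case: (j); case: (r); case: (s); do 4 case.
Qed.

Lemma Sijrs_line (x y u v z3 z4 k : F) (i j r s : bool)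
    (c := branch (PsiV1 x y) (PsiV2 x y)) :
  (x, y) \in Sset F -> k != 0 -> (u != 0) || (v != 0) ->
  c r * c i - c s = k * v -> c r - c j - c s + c s * c j = k * u ->
  c i * u - v = z3 -> u - v + c j * v = z4 ->
  i || (r != j) || (u != 0) -> j || (s != i) || (v != 0) ->
  [|| r, s == j | i == j] || (z3 != 0) -> s || (r != j) || (z4 != 0) ->
  ((x, y) \in Sijrs F i j r s) =
  [&& nzsquare ((-1) ^+ (i (+) j) * (u * - v)),
      nzsquare ((-1) ^+ (i (+) r) * (u * z3)) &
      nzsquare ((-1) ^+ (i (+) s) * (u * z4))].
Proof.
by move=> xyS; rewrite in_Sijrs//; apply: Eijrs_line; case: (inv_Sigma xyS).
Qed.

(** * The criteria at a fixed point of [S] *)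

Lemma nzsquareMl (u v : F) : nzsquare u -> nzsquare v -> nzsquare (u * v).
Proof.
by move=> /andP[u0 su] /andP[v0 sv]; rewrite /nzsquare mulf_neq0// squareMl.
Qed.

Lemma nzsquare_sqr (z : F) : z != 0 -> nzsquare (z ^+ 2).
Proof. by move=> z0; rewrite /nzsquare expf_neq0// square_sqr. Qed.

Lemma nzsquare1 : nzsquare (1 : F).
Proof. by rewrite -(expr1n _ 2) nzsquare_sqr ?oner_eq0. Qed.

Lemma eq_and3 (b1 b2 b3 c1 c2 c3 : bool) :
  b1 = c1 -> (c1 -> b2 = c2) -> (c1 -> b3 = c3) ->
  [&& b1, b2 & b3] = [&& c1, c2 & c3].
Proof. by move=> ->; case: c1 => // -> // ->. Qed.

Section Point.

Variables x y : F.
Hypothesis xyS : (x, y) \in Sset F.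

(** In these terms [b = N / D], [a = x * N / D], [1 - b = M / D] and [1 - a = y * M / D]. *)
Let D : F := x - y.
Let M : F := x - 1.
Let N : F := 1 - y.
Let a : F := PsiV1 x y.
Let b : F := PsiV2 x y.

Let sx : nzsquare x.
Proof. by move: xyS; rewrite in_Sset /nzsquare => /and5P[-> _ _ /andP[->]]. Qed.

Let sy : nzsquare y.
Proof. by move: xyS; rewrite in_Sset /nzsquare => /and5P[_ -> _ _ /andP[->]]. Qed.

Let x0 : x != 0. Proof. by case/andP: sx. Qed.
Let y0 : y != 0. Proof. by case/andP: sy. Qed.

Let D0 : D != 0.
Proof. by move: xyS; rewrite in_Sset subr_eq0 => /and5P[]. Qed.

Let M0 : M != 0.
Proof. by move: xyS; rewrite in_Sset subr_eq0 => /and5P[_ _ _ /andP[]]. Qed.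

Let N0 : N != 0.
Proof.
by rewrite subr_eq0 eq_sym; move: xyS; rewrite in_Sset => /and5P[_ _ _ _ /andP[]].
Qed.

Let b0 : b != 0. Proof. by rewrite mulf_neq0 ?invr_eq0. Qed.
Let a0 : a != 0. Proof. by rewrite mulf_neq0. Qed.

Let nz := (nzsquareMl, nzsquare_sqr, nzsquare1).

Ltac field_in_xy :=
  by rewrite /= /branch /a /b /PsiV1 /PsiV2 /M /N /D
             /f1 /f2 /f3 /f4 /g1 /g2 /g3 /g4; field; rewrite -/D ?D0.

Let eq0E := (oner_eq0, mulf_eq0, expf_eq0, oppr_eq0, invr_eq0, negPf D0, negPf M0,
  negPf N0, negPf x0, negPf y0, negPf a0, negPf b0).

Ltac nonzero := by rewrite /= ?eq0E ?orbT.

(** [(u, v)] spans the solution line, usually scaled by [D] to clear denominators; [z3] and [z4] are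
    the values there of [c i * u - v] and [u - v + c j * v], and [k] is the common factor of the two
    coefficients. *)
Ltac line u v z3 z4 k :=
  rewrite (@Sijrs_line x y u v z3 z4 k _ _ _ _ xyS);
  [ | nonzero | nonzero | field_in_xy | field_in_xy | field_in_xy | field_in_xy
  | nonzero | nonzero | nonzero | nonzero].

Lemma in_S01_10 :
  ((x, y) \in Sijrs F false true true false) =
  nzsquare ((1 - x) * (y - x)) &&
  nzsquare ((1 - y) * (x - y)).
Proof.
line D D (- (y * M)) N (- a * M / D ^+ 2).
(* The first signed product is [D ^+ 2], so its condition is automatic. *)
apply: (@eq_and3 _ _ _ true) => [|_|_].
- by rewrite (@nzsquareZ 1 (D ^+ 2) _ 1) ?nz//=; field_in_xy.
- by apply: (@nzsquareZ 1 y); rewrite ?nz//=; field_in_xy.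
- by apply: (@nzsquareZ 1 1); rewrite ?nz//=; field_in_xy.
Qed.

(** The right-hand side is that of [in_S01_10], which identifies the two sets. *)
Lemma in_S10_01 :
  ((x, y) \in Sijrs F true false false true) =
  nzsquare ((1 - x) * (y - x)) &&
  nzsquare ((1 - y) * (x - y)).
Proof.
line D D (- M) (x * N) (- b * y * M / D ^+ 2).
apply: (@eq_and3 _ _ _ true) => [|_|_].
- by rewrite (@nzsquareZ 1 (D ^+ 2) _ 1) ?nz//=; field_in_xy.
- by apply: (@nzsquareZ 1 1); rewrite ?nz//=; field_in_xy.
- by apply: (@nzsquareZ 1 x); rewrite ?nz//=; field_in_xy.
Qed.

Lemma in_S01_00 :
  ((x, y) \in Sijrs F false true false false) =
  nzsquare ((1 - x) * (x - y)) &&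
  nzsquare (g1 x y * (y - x)).
Proof.
line D (D * x) (- (x * M)) (- g1 x y) (- b * y * M / D ^+ 2).
apply: (@eq_and3 _ _ _ true) => [|_|_].
- by rewrite (@nzsquareZ 1 (x * D ^+ 2) _ 1) ?nz//=; field_in_xy.
- by apply: (@nzsquareZ 1 x); rewrite ?nz//=; field_in_xy.
- by apply: (@nzsquareZ 1 1); rewrite ?nz//=; field_in_xy.
Qed.

Lemma in_S10_00 :
  ((x, y) \in Sijrs F true false false false) =
  nzsquare (g2 x y * (x - y)) &&
  nzsquare ((1 - y) * (y - x)).
Proof.
line (D * y) D (- g2 x y) (N * y) (- a * M / D ^+ 2).
apply: (@eq_and3 _ _ _ true) => [|_|_].
- by rewrite (@nzsquareZ 1 (y * D ^+ 2) _ 1) ?nz//=; field_in_xy.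
- by apply: (@nzsquareZ 1 y); rewrite ?nz//=; field_in_xy.
- by apply: (@nzsquareZ 1 (y ^+ 2)); rewrite ?nz//=; field_in_xy.
Qed.

Lemma in_S10_11 :
  ((x, y) \in Sijrs F true false true true) =
  nzsquare ((1 - x) * (x - y)) &&
  nzsquare (g3 x y * (x - y)).
Proof.
line (D * x) D (- (y * M)) (g3 x y) (- b * M / D ^+ 2).
apply: (@eq_and3 _ _ _ true) => [|_|_].
- by rewrite (@nzsquareZ 1 (x * D ^+ 2) _ 1) ?nz//=; field_in_xy.
- by apply: (@nzsquareZ 1 (x * y)); rewrite ?nz//=; field_in_xy.
- by apply: (@nzsquareZ 1 x); rewrite ?nz//=; field_in_xy.
Qed.

Lemma in_S01_11 :
  ((x, y) \in Sijrs F false true true true) =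
  nzsquare (g4 x y * (y - x)) &&
  nzsquare ((1 - y) * (y - x)).
Proof.
line D (D * y) (g4 x y) (N * x) (- b * M / D ^+ 2).
apply: (@eq_and3 _ _ _ true) => [|_|_].
- by rewrite (@nzsquareZ 1 (y * D ^+ 2) _ 1) ?nz//=; field_in_xy.
- by apply: (@nzsquareZ 1 1); rewrite ?nz//=; field_in_xy.
- by apply: (@nzsquareZ 1 x); rewrite ?nz//=; field_in_xy.
Qed.

Lemma in_S11_01 :
  ((x, y) \in Sijrs F true true false true) =
  [&& nzsquare (x - 1 - y),
      nzsquare ((1 - x) * (x - y)) &
      nzsquare ((x - y) * f1 x y)].
Proof.
line (D * (x - 1 - y)) (- (D * y)) M (f1 x y) (b * M / D ^+ 2).
(* The first product is [y * D ^+ 2 * (x - 1 - y)]; its condition makes the factor [x - 1 - y] of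
   [u] removable from the other two. *)
apply: eq_and3 => [|s1|s1].
- by apply: (@nzsquareZ 1 (y * D ^+ 2)); rewrite ?nz//=; field_in_xy.
- by apply: (@nzsquareZ 1 (x - 1 - y)); rewrite ?nz//=; field_in_xy.
- by apply: (@nzsquareZ 1 (x - 1 - y)); rewrite ?nz//=; field_in_xy.
Qed.

Lemma in_S11_10 :
  ((x, y) \in Sijrs F true true true false) =
  [&& nzsquare (y - 1 - x),
      nzsquare ((y - x) * f2 x y) &
      nzsquare ((1 - y) * (y - x))].
Proof.
line (D * x) (- (D * (y - 1 - x))) (- f2 x y) N (- b * M / D ^+ 2).
apply: eq_and3 => [|s1|s1].
- by apply: (@nzsquareZ 1 (x * D ^+ 2)); rewrite ?nz//=; field_in_xy.
- by apply: (@nzsquareZ 1 x); rewrite ?nz//=; field_in_xy.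
- by apply: (@nzsquareZ 1 x); rewrite ?nz//=; field_in_xy.
Qed.

Lemma in_S00_10 :
  ((x, y) \in Sijrs F false false true false) =
  [&& nzsquare (y - x * y - x),
      nzsquare ((1 - x) * (x - y)) &
      nzsquare ((x - y) * f3 x y)].
Proof.
line (D * (y - x * y - x)) (- (D * x)) (x * y ^+ 2 * M) (f3 x y) (b * M / D ^+ 2).
apply: eq_and3 => [|s1|s1].
- by apply: (@nzsquareZ 1 (x * D ^+ 2)); rewrite ?nz//=; field_in_xy.
- by apply: (@nzsquareZ 1 ((y - x * y - x) * (x * y ^+ 2))); rewrite ?nz//=; field_in_xy.
- by apply: (@nzsquareZ 1 (y - x * y - x)); rewrite ?nz//=; field_in_xy.
Qed.

Lemma in_S00_01 :
  ((x, y) \in Sijrs F false false false true) =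
  [&& nzsquare (x - x * y - y),
      nzsquare ((y - x) * f4 x y) &
      nzsquare ((1 - y) * (y - x))].
Proof.
line (D * y) (- (D * (x - x * y - y))) (- f4 x y) (x ^+ 2 * y * N) (- b * M / D ^+ 2).
apply: eq_and3 => [|s1|s1].
- by apply: (@nzsquareZ 1 (y * D ^+ 2)); rewrite ?nz//=; field_in_xy.
- by apply: (@nzsquareZ 1 y); rewrite ?nz//=; field_in_xy.
- by apply: (@nzsquareZ 1 (x ^+ 2 * y ^+ 2)); rewrite ?nz//=; field_in_xy.
Qed.

(** Both coefficients of the linear equation vanish exactly when [x - 1 - y] and [x - x * y - y] do;
    the hypothesis keeps the solutions on a line. *)
Lemma in_S01_01 :
  (x - 1 - y != 0) || (x - x * y - y != 0) ->
  ((x, y) \in Sijrs F false true false true) =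
  [&& nzsquare ((x - x * y - y) * (x - 1 - y)),
      nzsquare (g4 x y * (y - x) * (x - 1 - y)) &
      nzsquare (g1 x y * (y - x) * (x - 1 - y))].
Proof.
move=> uv0.
line (D * (x - 1 - y)) (D * (x - x * y - y)) (- g4 x y) (y * g1 x y) (b * M / D ^+ 2).
apply: eq_and3 => [|s1|s1].
- by apply: (@nzsquareZ 1 (D ^+ 2)); rewrite ?nz//=; field_in_xy.
- by apply: (@nzsquareZ 1 1); rewrite ?nz//=; field_in_xy.
- by apply: (@nzsquareZ 1 y); rewrite ?nz//=; field_in_xy.
Qed.

Lemma in_S10_10 :
  (y - x * y - x != 0) || (y - 1 - x != 0) ->
  ((x, y) \in Sijrs F true false true false) =
  [&& nzsquare ((y - x * y - x) * (y - 1 - x)),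
      nzsquare (g2 x y * (x - y) * (y - 1 - x)) &
      nzsquare (g3 x y * (x - y) * (y - 1 - x))].
Proof.
move=> uv0.
line (D * (y - x * y - x)) (D * (y - 1 - x)) (x * g2 x y) (- g3 x y) (b * M / D ^+ 2).
apply: eq_and3 => [|s1|s1].
- by apply: (@nzsquareZ 1 (D ^+ 2)); rewrite ?nz//=; field_in_xy.
(* The computed product contains the factor [y - x * y - x] of [u], the listed one [y - 1 - x]; by
   [s1] these two have the same class. *)
- have e0 : y - 1 - x != 0.
    by case/andP: s1; rewrite mulf_eq0 negb_or => /andP[].
  by apply: (@nzsquareZ ((y - 1 - x) ^+ 2)
    (x * ((y - x * y - x) * (y - 1 - x))));
    rewrite ?(nzsquareMl sx s1) ?s1 ?nz//=; field_in_xy.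
- have e0 : y - 1 - x != 0.
    by case/andP: s1; rewrite mulf_eq0 negb_or => /andP[].
  by apply: (@nzsquareZ ((y - 1 - x) ^+ 2)
    ((y - x * y - x) * (y - 1 - x)));
    rewrite ?(nzsquareMl sx s1) ?s1 ?nz//=; field_in_xy.
Qed.

(** For [i = j] the first condition asks [- (u * v)] to be a nonzero square. In this and the next
    three cases [u * v] is 1 or [x * y], a nonzero square, so -1 would be a square. *)
Lemma in_S00_00 : ((x, y) \in Sijrs F false false false false) = false.
Proof.
line (1 : F) (1 : F) (- (y * M / D)) a (- (a * (y * M) / D)).
apply/and3P => -[+ _ _].
rewrite (@nzsquareZ 1 1 _ (- 1)) ?nz//=; last by ring.
by rewrite /nzsquare square_opp1 andbF.
Qed.

Lemma in_S00_11 : ((x, y) \in Sijrs F false false true true) = false.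
Proof.
line x y (a * x - y) (x - y + a * y) (- (b * M / D)).
apply/and3P => -[+ _ _].
rewrite (@nzsquareZ 1 (x * y) _ (- 1)) ?nz//=; last by ring.
by rewrite /nzsquare square_opp1 andbF.
Qed.

Lemma in_S11_00 : ((x, y) \in Sijrs F true true false false) = false.
Proof.
line y x (b * y - x) (y - x + b * x) (- (b * M / D)).
apply/and3P => -[+ _ _].
rewrite (@nzsquareZ 1 (x * y) _ (- 1)) ?nz//=; last by ring.
by rewrite /nzsquare square_opp1 andbF.
Qed.

Lemma in_S11_11 : ((x, y) \in Sijrs F true true true true) = false.
Proof.
line (1 : F) (1 : F) (- (M / D)) b (- (b * M / D)).
apply/and3P => -[+ _ _].
rewrite (@nzsquareZ 1 1 _ (- 1)) ?nz//=; last by ring.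
by rewrite /nzsquare square_opp1 andbF.
Qed.

End Point.

End Squares.

Theorem theorem2p11 (F : finFieldType) (q : nat) (hq : #|F| = q)
    (hq3 : (q = 3 %[mod 4])%N) :
  (Sijrs F false false false false = set0 /\
   Sijrs F false false true true = set0 /\
   Sijrs F true true false false = set0 /\
   Sijrs F true true true true = set0) /\
  Sijrs F true false false true = Sijrs F false true true false /\
  (forall x y : F, (x, y) \in Sset F ->
     (y + 1 - x <> 0 \/ x ^+ 2 - x - 1 <> 0) ->
     (x + 1 - y <> 0 \/ y ^+ 2 - y - 1 <> 0) ->
      ((x, y) \in Sijrs F false true true false <->
         nzsquare ((1 - y) * (x - y)) /\ nzsquare ((1 - x) * (y - x))) /\
      ((x, y) \in Sijrs F false true false false <->
         nzsquare ((1 - x) * (x - y)) /\ nzsquare (g1 x y * (y - x))) /\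
      ((x, y) \in Sijrs F true false false false <->
         nzsquare ((1 - y) * (y - x)) /\ nzsquare (g2 x y * (x - y))) /\
      ((x, y) \in Sijrs F true false true true <->
         nzsquare ((1 - x) * (x - y)) /\ nzsquare (g3 x y * (x - y))) /\
      ((x, y) \in Sijrs F false true true true <->
         nzsquare ((1 - y) * (y - x)) /\ nzsquare (g4 x y * (y - x))) /\
      ((x, y) \in Sijrs F true true false true <->
         [/\ nzsquare ((1 - x) * (x - y)),
             nzsquare (x - 1 - y) &
             nzsquare ((x - y) * f1 x y)]) /\
      ((x, y) \in Sijrs F true true true false <->
         [/\ nzsquare ((1 - y) * (y - x)),
             nzsquare (y - 1 - x) &
             nzsquare ((y - x) * f2 x y)]) /\
      ((x, y) \in Sijrs F false false true false <->
         [/\ nzsquare ((1 - x) * (x - y)),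
             nzsquare (y - x * y - x) &
             nzsquare ((x - y) * f3 x y)]) /\
      ((x, y) \in Sijrs F false false false true <->
         [/\ nzsquare ((1 - y) * (y - x)),
             nzsquare (x - x * y - y) &
             nzsquare ((y - x) * f4 x y)]) /\
      ((x, y) \in Sijrs F false true false true <->
         [/\ nzsquare ((x - x * y - y) * (x - 1 - y)),
             nzsquare (g1 x y * (y - x) * (x - 1 - y)) &
             nzsquare (g4 x y * (y - x) * (x - 1 - y))]) /\
      ((x, y) \in Sijrs F true false true false <->
         [/\ nzsquare ((y - x * y - x) * (y - 1 - x)),
             nzsquare (g2 x y * (x - y) * (y - 1 - x)) &
             nzsquare (g3 x y * (x - y) * (y - 1 - x))])).
Proof.
have cardF : (#|F| = 3 %[mod 4])%N by rewrite hq.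
split; last split.
- split; [|split; [|split]]; apply/setP => -[x y]; rewrite in_set0;
    apply/negP => xyE; have xyS := Sijrs_sub cardF xyE; move: xyE.
  + by rewrite in_S00_00.
  + by rewrite in_S00_11.
  + by rewrite in_S11_00.
  + by rewrite in_S11_11.
(* The criteria apply only on [S]; outside [S] neither set has points. *)
- apply/setP => -[x y]; have [xyS|xyNS] := boolP ((x, y) \in Sset F).
    by rewrite in_S10_01// in_S01_10.
  by apply/idP/idP => /(Sijrs_sub cardF); rewrite (negPf xyNS).
move=> x y xyS h1 h2.
(* When [x - 1 - y = 0], the quantity [x - x * y - y] equals [- (x ^+ 2 - x - 1)], so [h1] excludes
   a common zero. The next claim follows from [h2] by exchanging [x] and [y]. *)
have hS01_01 : (x - 1 - y != 0) || (x - x * y - y != 0).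
  rewrite -negb_and; apply/andP => -[/eqP e0 /eqP e1]; case: h1; apply.
    by rewrite -[RHS]oppr0 -e0; ring.
  have -> : x ^+ 2 - x - 1 = (x + 1) * (x - 1 - y) - (x - x * y - y) by ring.
  by rewrite e0 e1 mulr0 subr0.
have hS10_10 : (y - x * y - x != 0) || (y - 1 - x != 0).
  rewrite -negb_and; apply/andP => -[/eqP e1 /eqP e0]; case: h2; apply.
    by rewrite -[RHS]oppr0 -e0; ring.
  have -> : y ^+ 2 - y - 1 = (y + 1) * (y - 1 - x) - (y - x * y - x) by ring.
  by rewrite e0 e1 mulr0 subr0.
rewrite (in_S01_10 cardF xyS) (in_S01_00 cardF xyS) (in_S10_00 cardF xyS)
  (in_S10_11 cardF xyS) (in_S01_11 cardF xyS) (in_S11_01 cardF xyS) (in_S11_10 cardF xyS)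
  (in_S00_10 cardF xyS) (in_S00_01 cardF xyS) (in_S01_01 cardF xyS)//
  (in_S10_10 cardF xyS)//.
do 5 (split; first by split=> [/andP[]|[-> ->]]).
do 5 (split; first by split=> [/and3P[]|[-> -> ->]]).
by split=> [/and3P[]|[-> -> ->]].
Qed.
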